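(* Let $\lambda$ be a successor cardinal (i.e. $\lambda=\nu^+$ for an infinite cardinal $\nu$). Suppose there exists a $\lambda$-bounded $C$-sequence $\langle C_\delta\mid\delta\in E^{\lambda^+}_\lambda\rangle$ such that for every club $D\subseteq\lambda^+$ there is $\delta\in E^{\lambda^+}_\lambda$ with $\sup(\mathrm{nacc}(C_\delta)\cap D\cap E^{\lambda^+}_{<\lambda})=\delta$. Then there exists a $\lambda$-bounded $C$-sequence $\langle C_\delta\mid\delta\in E^{\lambda^+}_\lambda\rangle$ such that for every club $D\subseteq\lambda^+$ there is $\delta\in E^{\lambda^+}_\lambda$ such that the set $$\{\beta<\delta\mid \beta_1,\beta_2\in D,\ \text{where } \beta_1:=\min(C_\delta\setminus(\beta+1))\text{ and }\beta_2:=\min(C_\delta\setminus(\beta_1+1))\}$$ is stationary in $\delta$.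
   Context: $E^{\lambda^+}_\lambda=\{\alpha<\lambda^+\mid\mathrm{cf}(\alpha)=\lambda\}$, $E^{\lambda^+}_{<\lambda}=\{\alpha<\lambda^+\mid\mathrm{cf}(\alpha)<\lambda\}$. For a set of ordinals $A$, $\mathrm{acc}(A)=\{\alpha\in A\mid \sup(A\cap\alpha)=\alpha>0\}$ and $\mathrm{nacc}(A)=A\setminus\mathrm{acc}(A)$. A $C$-sequence over $S$ is $\langle C_\delta\mid\delta\in S\rangle$ with each $C_\delta$ a closed subset of $\delta$ with $\sup(C_\delta)=\delta$; it is $\lambda$-bounded if $\mathrm{otp}(C_\delta)\le\lambda$ for all $\delta$. *)

(* Defs.v *)
From mathcomp Require Import all_boot all_order.
From mathcomp Require Import boolp classical_sets functions cardinality.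
From mathcomp Require wochoice.

Set Implicit Arguments.
Unset Strict Implicit.
Unset Printing Implicit Defensive.

Local Open Scope classical_set_scope.
Local Open Scope card_scope.
Local Open Scope order_scope.

(* Ordinals are the elements of an arbitrary well-ordered type [W], which
   stands for an initial segment of the class of all ordinals; an ordinal [a]
   is identified with the set [below a] of its predecessors.  Every notion
   defined here at [a] only depends on the order type of [below a], and on
   subsets and maps of [below a], hence not on the choice of [W]. *)
Section Ordinals.
Context {d : Order.disp_t} {W : orderType d}.
Implicit Types (a b c t k l : W) (A C D S : set W).

Definition ordinals := wochoice.well_order (<=%O : rel W).

Definition below a : set W := [set x | x < a].

Definition least A a := A a /\ lbound A a.

Definition sup_is A a := supremums A a.

Definition order_type A a :=
  exists f : W -> W,
    set_bij A (below a) f /\ (forall x y, A x -> A y -> x < y -> f x < f y).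

Definition cardinal k := forall a, a < k -> ~ (below a #= below k).

Definition infinite_cardinal k := cardinal k /\ infinite_set (below k).

(* [successor_cardinal k l] : l = k^+ *)
Definition successor_cardinal k l := least [set m | cardinal m /\ k < m] l.

(* Non-strict domination, so that cf(0) = 0 and cf(a+1) = 1. *)
Definition cofinal a A :=
  A `<=` below a /\ (forall x, x < a -> exists2 y, A y & x <= y).

(* [cofinality a t] : cf(a) = t *)
Definition cofinality a t :=
  least [set s | exists2 A, cofinal a A & order_type A s] t.

(* E^k_t *)
Definition E_eq k t : set W := [set a | a < k /\ cofinality a t].

(* E^k_{<t} *)
Definition E_lt k t : set W :=
  [set a | a < k /\ exists2 s, s < t & cofinality a s].

(* sup(A \cap a) = a > 0 *)
Definition limit_point A a := sup_is (A `&` below a) a /\ exists x, x < a.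

Definition acc A : set W := [set a | A a /\ limit_point A a].

Definition nacc A : set W := A `\` acc A.

Definition closed_in a C :=
  C `<=` below a /\ (forall c, c < a -> limit_point C c -> C c).

Definition club a C := closed_in a C /\ sup_is C a.

(* [S] is not required to be a subset of [a]: only its trace on [a] matters. *)
Definition stationary a S := forall C, club a C -> S `&` C !=set0.

Definition C_sequence S (C : W -> set W) := forall a, S a -> club a (C a).

Definition bounded_C_sequence l S (C : W -> set W) :=
  C_sequence S C /\
  (forall a, S a -> exists2 t, t <= l & order_type (C a) t).

(* [min_after C b c] : c = min(C \ (b+1)), where b+1 = [set x | x <= b] *)
Definition min_after C b c := least (C `\` [set x | x <= b]) c.

End Ordinals.

Arguments ordinals {d} W.

(* Main.v *)
Require Import Defs.
From mathcomp Require Import all_boot all_order.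
From mathcomp Require Import boolp classical_sets functions cardinality.

Set Implicit Arguments.
Unset Strict Implicit.
Unset Printing Implicit Defensive.
Import Order.TTheory.

Local Open Scope classical_set_scope.
Local Open Scope card_scope.
Local Open Scope order_scope.

(* A sequence C' as required amounts to functions f1, f2 on each delta such that
   beta < f1 beta < f2 beta < delta with f1 beta, f2 beta in D for stationarily
   many beta: insert these two points right after each point beta of a club of
   closure points of f2 in C_delta.

   Such functions are found in three steps, each by assuming that every candidate
   is refuted by a club and intersecting the refuting clubs.
   - Some f makes (beta, f beta] meet nacc(C_delta) \cap D \cap E_(<lambda)
     stationarily often (guess_interval).
   - As (beta, f beta] contains at most nu points of C_delta and the nonstationary
     ideal is nu-complete, one of nu many selectors picks stationarily often a
     point of that intersection (guess_point).
   - A point gamma of cofinality at most nu which is a limit of D has nu many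
     candidates for a further point of D between beta and gamma (guess_pair). *)

(** * Cardinal arithmetic and order types in a well-order *)

Lemma cover_card_le T U (A : set T) (B : set U) (g : U -> T) :
  A `<=` g @` B -> A #<= B.
Proof. by move=> /subset_card_le /card_le_trans; apply; exact: card_image_le. Qed.

(** The left inverse of an injection of [A] into [B], given the value [t] off its range, enumerates
    [A] along [B]. *)
Lemma card_le_cover T U (A : set T) (B : set U) (t : T) :
  A #<= B -> exists g : U -> T, A `<=` g @` B.
Proof.
move=> /card_leP/unsquash f.
have /choice[g gP] : forall u, exists t' : T,
    forall x : A, \val (f x) = u -> \val x = t'.
  move=> u; have [[x fx]|nx] := pselect (exists x : A, \val (f x) = u).
    exists (\val x) => y fy; congr (\val _).
    by apply: (@inj _ _ _ f); rewrite ?inE //; apply: val_inj; rewrite fy fx.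
  by exists t => x fx; case: nx; exists x.
exists g => x Ax; exists (\val (f (SigSub (mem_set Ax)))).
  exact: set_valP.
by rewrite -(gP _ (SigSub (mem_set Ax)) erefl).
Qed.

Lemma card_le_setX T T' U U' (A : set T) (A' : set T') (B : set U) (B' : set U') :
  A #<= B -> A' #<= B' -> A `*` A' #<= B `*` B'.
Proof.
have [->|/set0P[[t t'] [At At']]] := eqVneq (A `*` A') set0; first by rewrite card_ge0.
move=> /(card_le_cover t)[g gA] /(card_le_cover t')[g' gA'].
apply: (@cover_card_le _ _ _ _ (fun p => (g p.1, g' p.2))) => -[x x'] [/= /gA[u Bu <-]].
by move=> /gA'[u' Bu' <-]; exists (u, u').
Qed.

(** With [g] enumerating [D] and [e j] enumerating [F j], the map sending [(u, v)] to [e (g u) v]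
    covers the union from the square of [K]. *)
Lemma card_le_bigcup I T U (K : set U) (D : set I) (F : I -> set T) :
  K `*` K #<= K -> D #<= K -> (forall i, D i -> F i #<= K) ->
  \bigcup_(i in D) F i #<= K.
Proof.
move=> KK DK FK; have [->|/set0P[t [i Di _]]] := eqVneq (\bigcup_(i in D) F i) set0.
  by rewrite card_ge0.
have [g gD] := card_le_cover i DK.
have /choice[e eF] : forall j, exists e : U -> T, D j -> F j `<=` e @` K.
  move=> j; have [/FK/(card_le_cover t)[e]|nD] := pselect (D j); first by exists e.
  by exists (fun=> t).
apply: card_le_trans KK; apply: (@cover_card_le _ _ _ _ (fun p => e (g p.1) p.2)).
move=> x [j Dj Fjx]; have [u Ku gu] := gD _ Dj; have [v Kv ev] := eF _ Dj _ Fjx.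
by exists (u, v) => //=; rewrite gu.
Qed.

Lemma card_le_setU T U (K : set U) (A B : set T) :
  infinite_set K -> K `*` K #<= K -> A #<= K -> B #<= K -> A `|` B #<= K.
Proof.
move=> /infiniteP nK KK AK BK.
have -> : (A `|` B)%classic = \bigcup_(b in [set: bool]) (if b then A else B).
  apply/seteqP; split=> [x [Ax|Bx]|x [[] _]]; [by exists true|by exists false| |];
  by [left|right].
apply: card_le_bigcup => //; last by case.
by apply: (card_le_trans _ nK); exact: (@countableP bool).
Qed.

Section WellOrder.
Context {d : Order.disp_t} {W : orderType d}.
Hypothesis hW : ordinals W.
Implicit Types (a b c x y z : W) (A B C D S : set W).

Lemma least_ex A : A !=set0 -> exists x, least A x.
Proof.
move=> [x Ax]; have [|z [[zA zP] _]] := hW (A := [pred x | `[< A x >]]).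
  by exists x; exact/asboolP.
exists z; split; first exact/asboolP.
by move=> y Ay; apply: zP; exact/asboolP.
Qed.

Lemma well_founded_lt : well_founded (fun x y => x < y).
Proof.
move=> x; apply: contrapT => nx.
have [|y [ny yP]] := @least_ex [set x | ~ Acc (fun x y => x < y) x]; first by exists x.
apply: ny; constructor => z zy; apply: contrapT => /yP; by rewrite leNgt zy.
Qed.

Lemma least_leP A x y : least A x -> y < x -> ~ A y.
Proof. by move=> [_ xP] yx /xP; rewrite leNgt yx. Qed.

Section Collapse.
Variables (T : Type) (R : T -> T -> Prop) (Rwf : well_founded R).
Variables (X : set T) (B : set W) (w0 : W).

(** Well-founded recursion that takes the least element of [B] not yet taken at an earlier point of
    [X]; [w0] is the default once [B] is exhausted. *)
Lemma collapse_ex : exists F : T -> W, forall p,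
  F p = xget w0 (least (B `\` F @` [set q | X q /\ R q p])).
Proof.
pose G p (F : forall q, R q p -> W) := xget w0
  (least (B `\` [set w | exists q (h : R q p), X q /\ F q h = w])).
exists (Fix Rwf (fun=> W) G) => p; rewrite Fix_eq.
  rewrite /G; congr (xget _ (least (_ `\` _))); apply/seteqP; split=> w.
    by case=> q [h [Xq <-]]; exists q.
  by case=> q [Xq h] <-; exists q, h.
move=> q f g fg; congr G; by apply: functional_extensionality_dep => y;
  apply: functional_extensionality_dep => h; rewrite fg.
Qed.

End Collapse.

(* Along R, each p is sent to the least element of [below a] not used before p. *)
Lemma card_le_below T (R : T -> T -> Prop) (X : set T) a :
  well_founded R -> (forall p q, R p q \/ p = q \/ R q p) ->
  (forall p, X p -> ~ (below a #<= [set q | X q /\ R q p])) -> X #<= below a.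
Proof.
move=> Rwf Rtri XP; have [F FE] := collapse_ex Rwf X (below a) a.
have FP p : X p -> least (below a `\` F @` [set q | X q /\ R q p]) (F p).
  move=> Xp; rewrite FE; apply: xgetPex; apply: least_ex.
  (* If nothing of [below a] were left, [F] would cover it from the predecessors of [p]. *)
  apply: contrapT => nE; apply: (XP _ Xp); apply: (@cover_card_le _ _ _ _ F).
  by move=> w aw; apply: contrapT => nw; apply: nE; exists w.
have Finj p q : X p -> X q -> R p q -> F p <> F q.
  by move=> Xp Xq pq E; have [[_ []]] := FP _ Xq; exists p.
have FinjX : {in X &, injective F}.
  move=> p q; rewrite !inE => Xp Xq E.
  have [/(Finj _ _ Xp Xq)//|[//|/(Finj _ _ Xq Xp)]] := Rtri p q; by rewrite E.
rewrite -(card_le_eql (inj_card_eq FinjX)); apply: subset_card_le => _ [p Xp <-].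
by have [[]] := FP _ Xp.
Qed.

(** The collapse of [A] never raises a point, so its image misses [a]; the least value missed is the
    order type. *)
Lemma order_type_ex A a : A `<=` below a -> exists2 t, t <= a & order_type A t.
Proof.
move=> Aa; have [F FE] := collapse_ex well_founded_lt A setT a.
have FP : forall x, least (~` (F @` [set y | A y /\ y < x])) (F x) /\ F x <= x.
  apply: (well_founded_ind well_founded_lt) => x IH.
  have nx : ~ (F @` [set y | A y /\ y < x]) x.
    by case=> y [_ yx] E; have [_] := IH _ yx; rewrite E leNgt yx.
  have Fx : least (~` (F @` [set y | A y /\ y < x])) (F x).
    by rewrite FE setTD; apply: xgetPex; apply: least_ex; exists x.
  by split=> //; case: Fx => _; exact.
have mono x y : A x -> x < y -> F x < F y.
  move=> Ax xy; rewrite ltNge; apply/negP => yx; have [[Fy _] _] := FP y.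
  move: yx; rewrite le_eqVlt => /orP[/eqP E|yx].
    by apply: Fy; exists x.
  have [[_ _] _] := FP x; have := least_leP (FP x).1 yx; rewrite /setC /=.
  move=> /contrapT[z [Az zx] E]; apply: Fy; exists z => //; split=> //.
  exact: lt_trans xy.
have [|t [nt tP]] := @least_ex (~` (F @` A)).
  exists a; case=> x Ax E; have [_] := FP x; rewrite E leNgt; case/negP.
  exact: Aa.
exists t.
  by apply: tP; case=> x Ax E; have [_] := FP x; rewrite E leNgt; case/negP; exact: Aa.
exists F; split; last by move=> x y Ax _; exact: mono.
split.
- move=> x Ax; rewrite /below /= ltNge; apply/negP => tFx.
  move: tFx; rewrite le_eqVlt => /orP[/eqP E|tx]; first by apply: nt; exists x.
  have /contrapT[z [Az _] E] := least_leP (FP x).1 tx; by apply: nt; exists z.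
- move=> x y; rewrite !inE => Ax Ay E; apply/eqP; rewrite eq_le !leNgt.
  by apply/andP; split; apply/negP => /mono; [move=> /(_ Ay)|move=> /(_ Ax)]; rewrite E ltxx.
- move=> w wt; have /contrapT[z Az E] := least_leP (conj nt tP) wt; by exists z.
Qed.

(** * Goedel's well-order of pairs and the square of an infinite ordinal *)

Lemma well_founded_minP T (R : T -> T -> Prop) :
  (forall A : set T, A !=set0 -> exists2 p, A p & forall q, A q -> ~ R q p) ->
  well_founded R.
Proof.
move=> RP p; apply: contrapT => np.
have [|q nq qP] := RP [set q | ~ Acc R q]; first by exists p.
by apply: nq; constructor => r rq; apply: contrapT => /qP.
Qed.

(** Comparing maxima first confines the predecessors of a pair to the square of its maximum plus
    one. *)
Definition godel_lt (p q : W * W) :=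
  let m := Order.max p.1 p.2 in let n := Order.max q.1 q.2 in
  m < n \/ m = n /\ (p.1 < q.1 \/ p.1 = q.1 /\ p.2 < q.2).

Lemma godel_lt_wf : well_founded godel_lt.
Proof.
apply: well_founded_minP => A [p0 Ap0].
have [|m [[p1 Ap1 E1] mP]] := @least_ex ((fun p => Order.max p.1 p.2) @` A).
  by exists (Order.max p0.1 p0.2), p0.
pose A1 := (A `&` [set p | Order.max p.1 p.2 = m])%classic.
have [|x [[p2 Ap2 E2] xP]] := @least_ex (fst @` A1); first by exists p1.1, p1.
pose A2 := (A1 `&` [set p | p.1 = x])%classic.
have [|y [[p3 Ap3 E3] yP]] := @least_ex (snd @` A2); first by exists p2.2, p2.
exists p3; first by case: Ap3 => -[].
move=> q Aq; case: Ap3 => -[Ap3 /= m3] x3; rewrite /godel_lt m3 x3 E3.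
case=> [|[qm [|[qx]]]]; apply/negP; rewrite -leNgt.
- by apply: mP; exists q.
- by apply: xP; exists q.
- by apply: yP; exists q.
Qed.

Lemma godel_lt_trichotomy p q : godel_lt p q \/ p = q \/ godel_lt q p.
Proof.
case: p q => [p1 p2] [q1 q2]; rewrite /godel_lt /=.
case: (ltgtP (Order.max p1 p2) (Order.max q1 q2)); [by left; left|by right; right; left|].
move=> E; case: (ltgtP p1 q1) => [?|?|p1q1]; [by left; right; auto|by right; right; right; auto|].
case: (ltgtP p2 q2) => [?|?|p2q2]; [by left; right; auto|by right; right; right; auto|].
by right; left; rewrite p1q1 p2q2.
Qed.

(** Hessenberg's theorem, by induction on [a]. When [below a] does not embed into a smaller segment,
    the Goedel predecessors of a pair form a set too small to cover [below a], so [card_le_below]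
    applies. *)
Lemma card_below_square a :
  infinite_set (below a) -> below a `*` below a #<= below a.
Proof.
elim/(well_founded_ind well_founded_lt): a => a IH ainf.
have [[b ba ab]|na] := pselect (exists2 b, b < a & below a #<= below b).
  have binf : infinite_set (below b) by move=> /(card_le_finite ab)/ainf.
  apply: (card_le_trans (card_le_setX ab ab)).
  apply: (card_le_trans (IH _ ba binf)); apply: subset_card_le => x xb.
  exact: lt_trans ba.
apply: card_le_below godel_lt_wf godel_lt_trichotomy _ => -[p1 p2] [/= p1a p2a] ap.
set m := Order.max p1 p2; have ma : m < a by rewrite gt_max p1a.
(* The point [m] is added to [below m] because a predecessor may have [m] as a coordinate. *)
have {ap} am : below a #<= (below m `|` [set m]) `*` (below m `|` [set m]).
  apply: (card_le_trans ap); apply: subset_card_le => -[q1 q2] [_ qp].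
  have : Order.max q1 q2 <= m by case: qp => /= [/ltW//|[-> _]].
  by rewrite ge_max !le_eqVlt => /andP[/orP[/eqP|] h1 /orP[/eqP|] h2]; split; by [left|right].
have [mfin|minf] := pselect (finite_set (below m)).
  apply: ainf; apply: (card_le_finite am).
  by apply: finite_setX; rewrite finite_setU; split=> //; exact: finite_set1.
apply: na; exists m => //; have mm := IH _ ma minf.
have m1 : below m `|` [set m] #<= below m.
  apply: card_le_setU => //; rewrite (card_le_eql (card_set1)).
  by move/infiniteP: minf; apply: card_le_trans; exact: card_leT.
by apply: (card_le_trans am); exact: (card_le_trans (card_le_setX m1 m1)).
Qed.

End WellOrder.

(** * Clubs and stationary sets *)

Section Clubs.
Context {d : Order.disp_t} {W : orderType d}.
Hypothesis hW : ordinals W.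
Implicit Types (a b c k l t x y z : W) (A B C D S : set W).

(** The least [s] equinumerous with [t] is a cardinal below [l], hence not above [k]. *)
Lemma card_lt_successor k l t :
  successor_cardinal k l -> t < l -> below t #<= below k.
Proof.
move=> [_ lP] tl.
have [|s [st sP]] := @least_ex _ _ hW [set s | below s #= below t].
  by exists t; rewrite /mkset card_eqxx.
have slet : s <= t by apply: sP; rewrite /mkset card_eqxx.
have sk : s <= k.
  rewrite leNgt; apply/negP => ks; have : l <= s; last by rewrite leNgt (le_lt_trans slet).
  apply: lP; split=> // r rs; rewrite (card_eqr st) => /sP; by rewrite leNgt rs.
rewrite -(card_le_eql st); apply: subset_card_le => x /lt_le_trans; exact.
Qed.

Lemma successor_card_gt k l : successor_cardinal k l -> ~ (below l #<= below k).
Proof.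
move=> [[lcard kl] _] lk; apply: (lcard _ kl); apply: Cantor_Bernstein => //.
by apply: subset_card_le => x /lt_trans; exact.
Qed.

(* cf(a) > k *)
Definition cf_above k a := forall A, A `<=` below a -> A #<= below k ->
  exists2 x, x < a & forall y, A y -> y < x.

(** Regularity of a successor: an unbounded [A] of size at most [k] would cover [below l] by at most
    [k] segments of size at most [k], together with [A] itself. *)
Lemma cf_above_successor k l :
  infinite_set (below k) -> successor_cardinal k l -> cf_above k l.
Proof.
move=> kinf kl A Al Ak; apply: contrapT => nb; apply: (successor_card_gt kl).
have kk := card_below_square hW kinf.
have : below l `<=` \bigcup_(y in A) below y `|` A.
  move=> x xl; apply: contrapT => nx; apply: nb; exists x => // y Ay.
  rewrite ltNge le_eqVlt; apply/negP => /orP[/eqP E|xy]; apply: nx; [right|left].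
    by rewrite E.
  by exists y.
move=> /subset_card_le /card_le_trans; apply; apply: card_le_setU => //.
by apply: card_le_bigcup => // y /Al; exact: card_lt_successor.
Qed.

(** An unbounded [A] has order type at least [l], so it has more than [k] elements. *)
Lemma cf_above_cofinality k l a :
  successor_cardinal k l -> cofinality a l -> cf_above k a.
Proof.
move=> kl [_ lP] A Aa Ak; apply: contrapT => nb; apply: (successor_card_gt kl).
have [t _ At] := order_type_ex hW Aa.
have lt : l <= t.
  apply: lP; exists A => //; split=> // x xa; apply: contrapT => nx; apply: nb.
  by exists x => // y Ay; rewrite ltNge; apply/negP => xy; apply: nx; exists y.
have [f [[_ _ fs] _]] := At.
have : below l `<=` f @` A by move=> x xl; apply: fs; exact: lt_le_trans lt.
by move=> /cover_card_le /card_le_trans; apply.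
Qed.

Lemma cf_aboveW k l a : k <= l -> cf_above l a -> cf_above k a.
Proof.
move=> kl al A Aa Ak; apply: al => //; apply: (card_le_trans Ak).
by apply: subset_card_le => x /lt_le_trans; apply.
Qed.

Lemma limit_pointP A a : limit_point A a <->
  (exists x, x < a) /\ forall x, x < a -> exists y, [/\ A y, x < y & y < a].
Proof.
split=> [[[_ aP] a0]|[a0 aP]]; split=> //.
  move=> x xa; apply: contrapT => nx; have : a <= x; last by rewrite leNgt xa.
  by apply: aP => y [Ay ya]; rewrite leNgt; apply/negP => xy; apply: nx; exists y.
split=> [y [_ /ltW]//|x xub]; rewrite leNgt; apply/negP => /aP[y [Ay xy ya]].
by have /xub : (A `&` below a)%classic y by []; rewrite leNgt xy.
Qed.

Lemma sup_isP A a : A `<=` below a ->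
  sup_is A a <-> forall x, x < a -> exists2 y, A y & x < y.
Proof.
move=> Aa; split=> [[_ aP] x xa|aP].
  apply: contrapT => nx; have : a <= x; last by rewrite leNgt xa.
  by apply: aP => y Ay; rewrite leNgt; apply/negP => xy; apply: nx; exists y.
split=> [y /Aa/ltW//|x xub]; rewrite leNgt; apply/negP => /aP[y Ay xy].
by have := xub _ Ay; rewrite leNgt xy.
Qed.

Lemma club_next a C x : club a C -> x < a -> exists y, [/\ C y, x < y & y < a].
Proof.
by move=> [[Ca _] /(sup_isP Ca)Cu] /Cu[y Cy xy]; exists y; split=> //; exact: Ca.
Qed.

Lemma clubI a C : C `<=` below a -> (forall c, c < a -> limit_point C c -> C c) ->
  (forall x, x < a -> exists2 y, C y & x < y) -> club a C.
Proof. by move=> Ca Cc Cu; split=> //; exact/sup_isP. Qed.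

Lemma limit_pointS A B a : A `<=` B -> limit_point A a -> limit_point B a.
Proof.
move=> AB /limit_pointP[a0 aP]; apply/limit_pointP; split=> // x /aP[y [Ay xy ya]].
by exists y; split=> //; exact: AB.
Qed.

Section CfAbove.
Variables (k a : W).
Hypotheses (kinf : infinite_set (below k)) (ka : cf_above k a).

Lemma countable_card_le T (A : set T) : countable A -> A #<= below k.
Proof. by move=> Ac; move/infiniteP: kinf; exact: card_le_trans. Qed.

(** The point [z] is the supremum of an omega-sequence in which each term exceeds both the previous
    term and its image under [h]. *)
Lemma limit_of_iterates (h : W -> W) x : (forall y, y < a -> h y < a) -> x < a ->
  exists z, [/\ x < z, z < a & forall w, w < z -> exists y, [/\ w < y, y < z & h y < z]].
Proof.
move=> ha xa.
have /choice[s sP] : forall y, exists s, y < a -> [/\ y < s, h y < s & s < a].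
  move=> y; have [ya|] := pselect (y < a); last by exists y.
  have [||s sa sP] := ka (A := [set y; h y]).
  - by move=> _ [->|->] //; exact: ha.
  - by apply: countable_card_le; apply: finite_set_countable; exact: finite_set2.
  by exists s => _; split=> //; apply: sP; [left|right].
pose u n := iter n s x.
have ua n : u n < a by elim: n => //= n /sP[].
have uS n : u n < u n.+1 /\ h (u n) < u n.+1 by have [] := sP _ (ua n).
have [||b ba ub] := ka (A := range u).
- by move=> _ [n _ <-]; exact: ua.
- by apply: countable_card_le; exact: card_image_le.
have [|z [zub zP]] := @least_ex _ _ hW (ubound (range u)).
  by exists b => y /ub/ltW.
have uz n : u n < z by apply: lt_le_trans (uS n).1 _; apply: zub; exists n.+1.
exists z; split; first exact: (uz 0%N).
  by apply: le_lt_trans ba; apply: zP => y /ub/ltW.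
move=> w wz; have [n wn] : exists n, w < u n.
  apply: contrapT => nw; have : z <= w; last by rewrite leNgt wz.
  by apply: zP => _ [n _ <-]; rewrite leNgt; apply/negP => ?; apply: nw; exists n.
exists (u n); split=> //; apply: lt_le_trans (uS n).2 _; apply: zub; by exists n.+1.
Qed.

(** A limit of iterates of a function bounding the next points of all the [D i] is a limit of each
    [D i]. Cutting down to [below a] covers the case of an empty [K]. *)
Lemma club_bigcap I (K : set I) (D : I -> set W) : K #<= below k ->
  (forall i, K i -> club a (D i)) -> club a (below a `&` \bigcap_(i in K) D i).
Proof.
move=> Kk Dclub; apply: clubI.
- by move=> x [].
- move=> c ca cl; split=> // i Ki; have [[_ Dc] _] := Dclub _ Ki; apply: Dc => //.
  by apply: limit_pointS cl => x [_]; apply.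
move=> x xa.
have /choice[nx nxP] : forall p : I * W, exists y,
    K p.1 -> p.2 < a -> [/\ D p.1 y, p.2 < y & y < a].
  move=> [i y] /=; have [[Ki ya]|n] := pselect (K i /\ y < a).
    by have [z] := club_next (Dclub _ Ki) ya; exists z.
  by exists y => Ki ya; case: n.
have /choice[h hP] : forall y, exists h, y < a -> h < a /\ forall i, K i -> nx (i, y) < h.
  move=> y; have [ya|] := pselect (y < a); last by exists y.
  have [||h ha hP] := ka (A := (fun i => nx (i, y)) @` K).
  - by move=> _ [i Ki <-]; have [] := nxP (i, y) Ki ya.
  - by apply: card_le_trans Kk; exact: card_image_le.
  by exists h => _; split=> // i Ki; apply: hP; exists i.
have [|z [xz za zP]] := @limit_of_iterates h x _ xa; first by move=> y /hP[].
exists z => //; split=> // i Ki; have [[_ Dc] _] := Dclub _ Ki; apply: Dc => //.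
apply/limit_pointP; split; first by exists x.
move=> w /zP[y [wy yz hz]]; have ya := lt_trans yz za.
have [Dn yn _] := nxP (i, y) Ki ya; exists (nx (i, y)); split=> //.
  exact: lt_trans yn.
by apply: lt_trans hz; apply: (hP _ ya).2.
Qed.

Lemma club_setI C D : club a C -> club a D -> club a (C `&` D).
Proof.
move=> Cc Dc; have := @club_bigcap bool setT (fun e : bool => if e then C else D).
have -> : (below a `&` \bigcap_(e in [set: bool]) (if e then C else D) = C `&` D)%classic.
  apply/seteqP; split=> [x [_ xP]|x [Cx Dx]]; first by have := xP true I; have := xP false I.
  by split=> [|[] _]//; case: Cc => -[Ca _] _; exact: Ca.
by apply=> [|[]//]; apply: countable_card_le; exact: countableP.
Qed.

(** If each [F i] missed a club, the intersection of these clubs would miss [S]. *)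
Lemma stationary_bigcup I (K : set I) (F : I -> set W) S : K #<= below k ->
  stationary a S -> S `&` below a `<=` \bigcup_(i in K) F i ->
  exists2 i, K i & stationary a (F i).
Proof.
move=> Kk Sst SF; apply: contrapT => nst.
have /choice[D DP] : forall i, exists D, K i -> club a D /\ F i `&` D = set0.
  move=> i; have [Ki|] := pselect (K i); last by exists setT.
  apply: contrapT => nD; apply: nst; exists i => // D Dc; apply: contrapT => FD.
  by apply: nD; exists D => _; split=> //; apply/eqP/negPn/negP => /set0P.
have [|x [Sx [xa xD]]] := Sst _ (club_bigcap (D := D) Kk _).
  by move=> i /DP[].
have [i Ki Fx] := SF _ (conj Sx xa).
have [_ /seteqP[FD _]] := DP _ Ki; by apply: (FD x); split=> //; exact: xD.
Qed.

Lemma club_limit_points C : club a C -> club a (C `&` [set x | limit_point C x]).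
Proof.
move=> Cc; have [[Ca Ccl] _] := Cc; apply: clubI.
- by move=> x [/Ca].
- move=> c ca cl; suff lc : limit_point C c by split=> //; exact: Ccl.
  by apply: limit_pointS cl => x [].
move=> x xa; have /choice[h hP] : forall y, exists h, y < a -> [/\ C h, y < h & h < a].
  move=> y; have [ya|] := pselect (y < a); last by exists y.
  by have [z] := club_next Cc ya; exists z.
have [|z [xz za zP]] := @limit_of_iterates h x _ xa; first by move=> y /hP[].
have lz : limit_point C z.
  apply/limit_pointP; split; first by exists x.
  move=> w /zP[y [wy yz hz]]; have [Ch yh _] := hP _ (lt_trans yz za).
  by exists (h y); split=> //; exact: lt_trans yh.
by exists z => //; split=> //; exact: Ccl.
Qed.

(** As initial segments of [C] have size at most [k], their images under [h] are bounded below [a],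
    and iterating such bounds reaches a closure point. *)
Lemma club_closure_points C (h : W -> W) : club a C ->
  (forall x, x < a -> C `&` below x #<= below k) -> (forall x, x < a -> h x < a) ->
  club a [set z | C z /\ forall w, C w -> w < z -> h w < z].
Proof.
move=> Cc Ck ha; have [[Ca Ccl] _] := Cc; apply: clubI.
- by move=> x [/Ca].
- move=> c ca cl; split.
    by apply: Ccl => //; apply: limit_pointS cl => x [].
  move=> w Cw wc; have /limit_pointP[_ /(_ _ wc)[y [[_ yP] wy yc]]] := cl.
  by apply: lt_trans yc; exact: yP.
move=> x xa; have /choice[g gP] : forall y, exists g, y < a ->
    [/\ g < a, (exists2 v, C v & y < v /\ v < g) & forall w, C w -> w < y -> h w < g].
  move=> y; have [ya|] := pselect (y < a); last by exists y.
  have [||g ga gP] := ka (A := h @` (C `&` below y)).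
  - by move=> _ [w [Cw wy] <-]; apply: ha; exact: Ca.
  - by apply: card_le_trans (Ck _ ya); exact: card_image_le.
  have [v [Cv yv va]] := club_next Cc ya.
  have [v' [Cv' vv' v'a]] := club_next Cc va.
  exists (Order.max g v') => _; split; first by rewrite gt_max ga.
    by exists v => //; split=> //; rewrite lt_max vv' orbT.
  by move=> w Cw wy; rewrite lt_max gP //; exists w.
have [|z [xz za zP]] := @limit_of_iterates g x _ xa; first by move=> y /gP[].
exists z => //; split.
  apply: Ccl => //; apply/limit_pointP; split; first by exists x.
  move=> w /zP[y [wy yz gz]]; have [_ [v Cv [yv vg]] _] := gP _ (lt_trans yz za).
  by exists v; split=> //; [exact: lt_trans yv|exact: lt_trans gz].
move=> w Cw /zP[y [wy yz gz]]; have [_ _ gw] := gP _ (lt_trans yz za).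
by apply: lt_trans gz; exact: gw.
Qed.

End CfAbove.
End Clubs.

(** * Club guessing *)

Section Guessing.
Context {d : Order.disp_t} {W : orderType d}.
Hypothesis hW : ordinals W.
Variables (k kappa : W) (E : set W).
Hypotheses (kinf : infinite_set (below k)) (kappa_cf : cf_above k kappa).
Hypothesis E_cf : forall a, E a -> cf_above k a.
Implicit Types (a b x y z delta beta gamma : W) (D : set W).

Definition guesses (S : set W -> W -> set W) := forall D, club kappa D ->
  exists2 delta, E delta & stationary delta (S D delta).

(** Failure in a form that choice turns into a family of refuting clubs. *)
Lemma not_guesses (S : set W -> W -> set W) : ~ guesses S ->
  exists D, club kappa D /\ forall delta, E delta ->
    exists c, club delta c /\ S D delta `&` c = set0.
Proof.
move=> nS; apply: contrapT => nD; apply: nS => D Dc; apply: contrapT => nd.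
apply: nD; exists D; split=> // delta Ed; apply: contrapT => nc; apply: nd.
exists delta => // c cc; apply: contrapT => Sc; apply: nc; exists c; split=> //.
by apply/eqP/negPn/negP => /set0P.
Qed.

(* The candidate for f at stage n sends beta to the next point of the club c_n,
   where c_(n+1) witnesses the failure of that candidate.  If y is the last point
   of the intersection c of the c_n below a guessed point gamma, then gamma
   bounds all of the candidates at y, whose supremum is another point of c. *)
Lemma guess_interval (C N : W -> set W) :
  (forall delta, E delta -> club delta (C delta)) ->
  (forall delta, N delta `<=` nacc (C delta)) ->
  (forall D, club kappa D -> exists2 delta, E delta &
     forall x, x < delta -> exists2 y, N delta y /\ D y & x < y) ->
  exists2 f : W -> W -> W,
    forall delta beta, E delta -> beta < delta -> f delta beta < delta &
    guesses (fun D delta =>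
      [set beta | exists gamma,
         [/\ N delta gamma, D gamma, beta < gamma & gamma <= f delta beta]]).
Proof.
move=> Cclub NC NP; apply: contrapT => nf.
pose S (f : W -> W -> W) D delta := [set beta | exists gamma,
  [/\ N delta gamma, D gamma, beta < gamma & gamma <= f delta beta]].
(* [G] assigns to each candidate a refuting club of [kappa] and one in each [delta]; the empty sets
   are defaults for maps that leave some [delta]. *)
have /choice[G GP] : forall f : W -> W -> W, exists Dc : set W * (W -> set W),
    (forall delta beta, E delta -> beta < delta -> f delta beta < delta) ->
    club kappa Dc.1 /\ forall delta, E delta ->
      club delta (Dc.2 delta) /\ S f Dc.1 delta `&` Dc.2 delta = set0.
  move=> f; have [fE|] := pselect (forall delta beta,
      E delta -> beta < delta -> f delta beta < delta); last by exists (set0, fun=> set0).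
  have [|D [Dc DP]] := @not_guesses (S f).
    by move=> fg; apply: nf; exists f.
  have /choice[c cP] : forall delta, exists c, E delta ->
      club delta c /\ S f D delta `&` c = set0.
    move=> delta; have [/DP[c]|] := pselect (E delta); last by exists set0.
    by exists c.
  by exists (D, c).
pose next (c : W -> set W) delta beta := xget beta (least [set y | c delta y /\ beta < y]).
pose cs n := iter n (fun c delta => c delta `&` (G (next c)).2 delta)%classic C.
have nextP c delta beta : club delta (c delta) -> beta < delta ->
    least [set y | c delta y /\ beta < y] (next c delta beta).
  move=> cc bd; apply: xgetPex; apply: least_ex => //.
  by have [y []] := club_next cc bd; exists y.
have next_lt c : (forall delta, E delta -> club delta (c delta)) ->
    forall delta beta, E delta -> beta < delta -> next c delta beta < delta.
  move=> cc delta beta Ed bd; have [[+ _] _] := nextP _ _ _ (cc _ Ed) bd.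
  by have [[cd _] _] := cc _ Ed; exact: cd.
have csP n : forall delta, E delta -> club delta (cs n delta).
  elim: n => [|n IH]; first exact: Cclub.
  move=> delta Ed; apply: (club_setI hW kinf (E_cf Ed)); first exact: IH.
  by have [_ /(_ _ Ed)[]] := GP _ (next_lt _ IH).
have csS n m delta : (n <= m)%N -> cs m delta `<=` cs n delta.
  by move=> /subnK <-; elim: (m - n)%N => //= r IH x [/IH].
pose f n := next (cs n).
have fP n : forall delta beta, E delta -> beta < delta -> f n delta beta < delta.
  by apply: next_lt; exact: csP.
pose Dw := (below kappa `&` \bigcap_(n in [set: nat]) (G (f n)).1)%classic.
have Dwc : club kappa Dw.
  apply: (club_bigcap hW kinf kappa_cf) => [|n _]; first exact: countable_card_le.
  exact: (GP _ (fP n)).1.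
have [delta Ed deltaP] := NP _ Dwc.
pose c := (below delta `&` \bigcap_(n in [set: nat]) cs n delta)%classic.
have cclub : club delta c.
  apply: (club_bigcap hW kinf (E_cf Ed)) => [|n _]; first exact: countable_card_le.
  exact: csP.
have [[_ cclosed] _] := cclub.
have [[Cd _] _] := Cclub _ Ed.
have cC x : c x -> C delta x by move=> [_ /(_ 0%N)]; apply.
have [x0 x0d _] := E_cf Ed (@sub0set _ _) (card_ge0 _ _).
have [y0 [cy0 _ y0d]] := club_next cclub x0d.
have [gamma [Ng Dg] y0g] := deltaP _ y0d.
have [Cg gnacc] := NC _ _ Ng; have gd := Cd _ Cg.
have glim : ~ limit_point (C delta) gamma by move=> gl; apply: gnacc.
have [|y [yub yP]] := @least_ex _ _ hW (ubound (c `&` below gamma)).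
  by exists gamma => x [_ /ltW].
(* Otherwise [gamma] would be a limit of [c], hence of [C delta], against its being in [nacc]. *)
have yg : y < gamma.
  rewrite ltNge; apply/negP => gy; apply: glim; apply/limit_pointP.
  split=> [|x xg]; first by exists y0.
  apply: contrapT => nx; have : y <= x; last by rewrite leNgt (lt_le_trans xg).
  apply: yP => v [cv vg]; rewrite leNgt; apply/negP => xv; apply: nx; exists v.
  by split=> //; exact: cC.
have yd := lt_trans yg gd.
(* A supremum that is not attained is a limit point of [c], which is closed. *)
have cy : c y.
  apply: contrapT => ncy; apply: (ncy); apply: cclosed => //; apply/limit_pointP.
  have ylt v : c v -> v < gamma -> v < y.
    move=> cv vg; rewrite lt_neqAle yub // andbT; apply/eqP => vy.
    by apply: ncy; rewrite -vy.
  split=> [|x xy]; first by exists y0; exact: ylt.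
  apply: contrapT => nx; have : y <= x; last by rewrite leNgt xy.
  apply: yP => v [cv vg]; rewrite leNgt; apply/negP => xv; apply: nx; exists v.
  by split=> //; exact: ylt.
pose e n := f n delta y.
have eP n : least [set x | cs n delta x /\ y < x] (e n) by apply: nextP => //; exact: csP.
(* Otherwise [gamma] lies in [(y, e n]], which puts [y] in the set refuted at stage [n], although
   [y] belongs to the refuting club included in stage [n.+1]. *)
have eg n : e n < gamma.
  rewrite ltNge; apply/negP => ge; have [_ /(_ _ Ed)[_ /seteqP[Se _]]] := GP _ (fP n).
  apply: (Se y); split; last by have [_ /(_ n.+1 I)[]] := cy.
  by exists gamma; split=> //; have [_ /(_ n I)] := Dg.
have ele n m : (n <= m)%N -> e n <= e m.
  by move=> nm; apply: (eP n).2; have [[cm ym] _] := eP m; split=> //; exact: csS cm.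
have [|z [zub zP]] := @least_ex _ _ hW (ubound (range e)).
  by exists gamma => _ [n _ <-]; exact/ltW.
have zsup x : x < z -> exists n, x < e n.
  move=> xz; apply: contrapT => nx; have : z <= x; last by rewrite leNgt xz.
  by apply: zP => _ [n _ <-]; rewrite leNgt; apply/negP => xe; apply: nx; exists n.
have ez n : e n <= z by apply: zub; exists n.
have zg : z <= gamma by apply: zP => _ [n _ <-]; exact/ltW.
have yz : y < z by apply: lt_le_trans (ez 0%N); have [[]] := eP 0%N.
have zd := le_lt_trans zg gd.
(* As [e] is nondecreasing, either it reaches [z] and stays there, or [z] is a limit of every
   stage. *)
have cz : c z.
  split=> // m _; have [[n en]|ne] := pselect (exists n, e n = z).
    apply: (csS _ _ _ (leq_maxl m n)); have <- : e (maxn m n) = z.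
      by apply/eqP; rewrite eq_le ez -en ele // leq_maxr.
    by have [[]] := eP (maxn m n).
  have [[_ mclosed] _] := csP m _ Ed; apply: mclosed => //; apply/limit_pointP.
  split=> [|x /zsup[n xn]]; first by exists y.
  exists (e (maxn m n)); split.
  - by have [[+ _] _] := eP (maxn m n); apply: csS; exact: leq_maxl.
  - by apply: lt_le_trans xn _; apply: ele; exact: leq_maxr.
  - rewrite lt_neqAle ez andbT; apply/eqP => E'; by apply: ne; exists (maxn m n).
(* Below [gamma], [z] would be a point of [c] beyond the last one [y]; equal to [gamma], it makes
   [gamma] a limit of [C delta]. *)
move: zg; rewrite le_eqVlt => /orP[/eqP zg|zg]; last first.
  by have := yub _ (conj cz zg); rewrite leNgt yz.
apply: glim; apply/limit_pointP; split=> [|x]; first by exists y.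
rewrite -zg => /zsup[n xn]; exists (e n); rewrite zg; split=> //.
by have [[+ _] _] := eP n; exact: (csS 0%N).
Qed.

(** Candidate [i] picks the [i]-th entry of an enumeration, along [below k], of the points of
    [N delta] up to [f delta beta]. At a [delta] guessed for the intersection of all refuting clubs
    [D i], the sets [S i (D i) delta] cover a stationary set, so one of them is stationary. *)
Lemma guess_point (C N : W -> set W) (f : W -> W -> W) :
  (forall delta x, E delta -> x < delta -> C delta `&` below x #<= below k) ->
  (forall delta, N delta `<=` C delta) ->
  (forall delta beta, E delta -> beta < delta -> f delta beta < delta) ->
  guesses (fun D delta =>
      [set beta | exists gamma,
         [/\ N delta gamma, D gamma, beta < gamma & gamma <= f delta beta]]) ->
  exists g : W -> W -> W, guesses (fun D delta =>
    [set beta | [/\ beta < g delta beta, g delta beta < delta,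
                    N delta (g delta beta) & D (g delta beta)]]).
Proof.
move=> Ck NC fE fg; apply: contrapT => ng.
have /choice[e eP] : forall db : W * W, exists e : W -> W,
    E db.1 -> db.2 < db.1 ->
    forall x, N db.1 x -> x <= f db.1 db.2 -> x < db.1 -> exists2 i, i < k & e i = x.
  move=> [delta beta] /=; have [[Ed bd]|nd] := pselect (E delta /\ beta < delta); last first.
    by exists id => Ed bd; case: nd.
  (* A strict bound [v] is taken because [f delta beta] may itself be one of the points to
     enumerate. *)
  have [|v vd vP] := E_cf Ed (A := [set f delta beta]) _ (countable_card_le kinf (countable1 _)).
    by move=> _ ->; exact: fE.
  have [e eP] := card_le_cover beta (Ck _ _ Ed vd); exists e => _ _ x Nx xf _.
  have [|i ik ei] := eP x; last by exists i.
  by split; [exact: NC|exact: le_lt_trans (vP _ erefl)].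
pose S i D delta := [set beta | let g := e (delta, beta) i in
  [/\ beta < g, g < delta, N delta g & D g]].
have /choice[D DP] : forall i, exists D, club kappa D /\ forall delta, E delta ->
    exists c, club delta c /\ S i D delta `&` c = set0.
  by move=> i; apply: not_guesses => Si; apply: ng; exists (fun delta beta => e (delta, beta) i).
have [|delta Ed Sd] := fg (below kappa `&` \bigcap_(i in below k) D i)%classic.
  by apply: (club_bigcap hW kinf kappa_cf) => [|i _]; [exact: card_lexx|have [] := DP i].
have [|i ik Si] := stationary_bigcup hW kinf (E_cf Ed) (K := below k)
  (F := fun i => S i (D i) delta) (card_lexx _) Sd.
  move=> beta [[gamma [Ng [_ Dg] bg gf]] bd].
  have gd := le_lt_trans gf (fE _ _ Ed bd).
  have [i ik ei] := eP (delta, beta) Ed bd gamma Ng gf gd.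
  by exists i => //; rewrite /S /= ei; split=> //; exact: Dg.
have [_ /(_ _ Ed)[c [cc]]] := DP i; have [x Sx] := Si _ cc.
by move=> /seteqP[/(_ x Sx)].
Qed.

(* For gamma = f beta in E_(<lambda), the points max (D_n \cap (e_gamma i + 1))
   do not increase with n, so they stabilise for a fixed i < k, at a point of all
   the D_n which is above beta for i large enough. *)
Lemma guess_pair (T : set W) (f : W -> W -> W) :
  (forall gamma, T gamma -> exists e : W -> W, forall x, x < gamma ->
     exists2 i, i < k & x <= e i < gamma) ->
  guesses (fun D delta =>
    [set beta | [/\ beta < f delta beta, f delta beta < delta,
                    T (f delta beta) & D (f delta beta)]]) ->
  exists f1 f2 : W -> W -> W, guesses (fun D delta =>
    [set beta | [/\ beta < f1 delta beta, f1 delta beta < f2 delta beta,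
                    f2 delta beta < delta, D (f1 delta beta) & D (f2 delta beta)]]).
Proof.
move=> Tlad fg; apply: contrapT => ng.
have /choice[e eP] : forall gamma, exists e : W -> W, T gamma ->
    forall x, x < gamma -> exists2 i, i < k & x <= e i < gamma.
  move=> gamma; have [/Tlad[e eP]|] := pselect (T gamma); last by exists id.
  by exists e.
(* The maximum of [D] up to [x], with default [x] when there is none. *)
pose mx D x := xget x [set y | [/\ D y, y <= x & forall z, D z -> z <= x -> z <= y]].
have mxP D x y : club kappa D -> x < kappa -> D y -> y <= x ->
    [/\ D (mx D x), mx D x <= x & forall z, D z -> z <= x -> z <= mx D x].
  move=> [[Dk Dcl] _] xk Dy yx.
  apply: (@xgetPex _ x
    [set y | [/\ D y, y <= x & forall z, D z -> z <= x -> z <= y]]).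
  have [|z [zub zP]] := @least_ex _ _ hW (ubound (D `&` [set y | y <= x])).
    by exists x => v [].
  have zx : z <= x by apply: zP => v [].
  exists z; split=> //; last by move=> v Dv vx; exact: zub.
  apply: contrapT => nDz; apply: (nDz); apply: Dcl; first exact: le_lt_trans xk.
  have ltz v : D v -> v <= x -> v < z.
    move=> Dv vx; rewrite lt_neqAle zub // andbT; apply/eqP => vz.
    by apply: nDz; rewrite -vz.
  apply/limit_pointP; split=> [|w wz]; first by exists y; exact: ltz.
  apply: contrapT => nw; have : z <= w; last by rewrite leNgt wz.
  apply: zP => v [Dv vx]; rewrite leNgt; apply/negP => wv; apply: nw; exists v.
  by split=> //; exact: ltz.
pose f1 D i delta beta := mx D (e (f delta beta) i).
pose S f1 D delta := [set beta | [/\ beta < f1 delta beta, f1 delta beta < f delta beta,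
                    f delta beta < delta, D (f1 delta beta) & D (f delta beta)]].
have /choice[D' D'P] : forall Di : set W * W, exists D', club kappa D' /\
    forall delta, E delta -> exists c, club delta c /\ S (f1 Di.1 Di.2) D' delta `&` c = set0.
  by move=> [D i]; apply: not_guesses => Si; apply: ng; exists (f1 D i), f.
(* Each stage adds the refuting clubs of all the candidates, one for each [i < k], that are formed
   from the previous stage. *)
pose Ds n := iter n (fun D => D `&` (below kappa `&` \bigcap_(i in below k) D' (D, i)))%classic
  (below kappa).
have kcl : club kappa (below kappa).
  apply: clubI => // x xk.
  have [|v vk xv] := kappa_cf (A := [set x]) _ (countable_card_le kinf (countable1 _)).
    by move=> _ ->.
  by exists v => //; exact: xv.
have Dsc n : club kappa (Ds n).
  elim: n => //= n IH; apply: (club_setI hW kinf kappa_cf) => //.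
  by apply: (club_bigcap hW kinf kappa_cf) => [|i _]; [exact: card_lexx|have [] := D'P (Ds n, i)].
have DsS n m : (n <= m)%N -> Ds m `<=` Ds n.
  by move=> /subnK <-; elim: (m - n)%N => //= r IH x [/IH].
pose Dw := (below kappa `&` \bigcap_(n in [set: nat]) Ds n)%classic.
have Dwc : club kappa Dw.
  by apply: (club_bigcap hW kinf kappa_cf) => [|n _]; [exact: countable_card_le|].
(* Guessing limit points of [Dw] leaves room for a point of [Dw] between [beta] and the guessed
   [gamma]. *)
have [delta Ed Sd] := fg _ (club_limit_points hW kinf kappa_cf Dwc).
have natk : [set: nat] #<= below k by exact/infiniteP.
pose F i n := S (f1 (Ds n) i) (D' (Ds n, i)) delta.
(* Completeness is used twice: here to fix the index [i], and then to fix the stage [n]. *)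
have [|i ik] := stationary_bigcup hW kinf (E_cf Ed) (K := below k)
  (F := fun i => \bigcup_(n in [set: nat]) F i n) (card_lexx _) Sd.
  move=> beta [[bg gd Tg [[gk Dg] /limit_pointP[_ gl]]] bd].
  set gamma := f delta beta in bg gd Tg gk Dg gl.
  have [x [Dx bx xg]] := gl _ bg; have [i ik /andP[xe eg]] := eP _ Tg _ xg.
  exists i => //; pose m n := mx (Ds n) (e gamma i).
  have mP n : [/\ Ds n (m n), m n <= e gamma i & forall z, Ds n z -> z <= e gamma i -> z <= m n].
    apply: (mxP _ _ x) => //; first exact: lt_trans gk.
    by have [_] := Dx; apply.
  have [|_ [[n _ <-] nP]] := @least_ex _ _ hW (range m); first by exists (m 0%N), 0%N.
  (* One repetition is enough: it puts the value [m n], computed from stage [n], into the club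
     refuting the candidate of stage [n]. *)
  have mE : m n.+1 = m n.
    have le_mn : m n <= m n.+1 by apply: nP; exists n.+1.
    apply/eqP; rewrite eq_le le_mn andbT.
    have [_ _ mn] := mP n; have [Dn ne _] := mP n.+1; apply: mn => //.
    exact: (DsS n n.+1).
  have [Dn ne _] := mP n.+1; exists n => //; rewrite /F /S /= /f1 -/gamma -/(m n); split=> //.
  - apply: (lt_le_trans bx); have [_ _] := mP n; apply=> //.
    by have [_] := Dx; apply.
  - by apply: le_lt_trans eg; have [] := mP n.
  - by move: Dn; rewrite mE => -[_ [_]]; apply.
  - by have [_ [_]] := Dg n.+1 I; apply.
move=> Si; have [|n _ Sn] := stationary_bigcup hW kinf (E_cf Ed) (F := F i) natk Si.
  by move=> x [].
have [_ /(_ _ Ed)[c [cc]]] := D'P (Ds n, i); have [x Sx] := Sn _ cc.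
by move=> /seteqP[/(_ x Sx)].
Qed.

End Guessing.

(** * Inserting two points after each closure point *)

Section Assembly.
Context {d : Order.disp_t} {W : orderType d}.
Hypothesis hW : ordinals W.
Variables (k l : W).
Hypotheses (kinf : infinite_set (below k)) (kl : successor_cardinal k l).
Implicit Types (a b x y z : W) (A B C D : set W).

Lemma order_type_card_le A t : order_type A t -> A #<= below t.
Proof.
move=> [f [[fA finj _] _]]; rewrite -(card_le_eql (inj_card_eq finj)).
by apply: subset_card_le => _ [x /fA fx <-].
Qed.

(** The isomorphism embeds the part of [A] below [x] into [below (f y)], where [f y < t <= l]. *)
Lemma order_type_card_below A a t : A `<=` below a ->
  (forall x, x < a -> exists2 y, A y & x < y) -> t <= l -> order_type A t ->
  forall x, x < a -> A `&` below x #<= below k.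
Proof.
move=> Aa Au tl [f [[ft finj _] fmono]] x /Au[y Ay xy].
apply: card_le_trans (card_lt_successor hW kl (lt_le_trans (ft _ Ay) tl)).
have <- : (f @` (A `&` below x) #<= below (f y)) = (A `&` below x #<= below (f y)).
  apply: card_le_eql; apply: inj_card_eq => u v; rewrite !inE => -[Au' _] [Av _].
  by apply: finj; rewrite inE.
apply: subset_card_le => _ [z [Az zx] <-]; apply: fmono => //; exact: lt_trans xy.
Qed.

(** A longer [A] would have a point at position [l], with more than [k] predecessors in [A]. *)
Lemma order_type_le_successor A a : A `<=` below a ->
  (forall x, A x -> A `&` below x #<= below k) -> exists2 t, t <= l & order_type A t.
Proof.
move=> Aa Ak; have [t _ At] := order_type_ex hW Aa; exists t => //.
rewrite leNgt; apply/negP => lt; have [f [[_ finj fs] fmono]] := At.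
have [x Ax fx] := fs _ lt; apply: (successor_card_gt kl).
apply: card_le_trans (Ak _ Ax); apply: (@cover_card_le _ _ _ _ f) => y yl.
have [z Az fz] := fs _ (lt_trans yl lt); exists z => //; split=> //.
rewrite /below /= ltNge le_eqVlt; apply/negP => /orP[/eqP xz|/(fmono _ _ Ax Az)].
  by move: yl; rewrite /below /= -fz -fx xz ltxx.
by rewrite fx fz ltNge ltW.
Qed.

Section InsertPairs.
Variables (a : W) (C : set W) (f1 f2 : W -> W).
Hypotheses (ka : cf_above k a) (Ca : club a C).
Hypothesis Ck : forall x, x < a -> C `&` below x #<= below k.

Definition paired x := [/\ x < f1 x, f1 x < f2 x & f2 x < a].

(** Falling back to [w] at unpaired points keeps the function inside [below a], whatever [f1] and
    [f2] are. At a paired point, [f2] stays below every later closure point. *)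
Definition pair_closed : set W := [set z | C z /\ forall w, C w -> w < z ->
  (if pselect (paired w) then f2 w else w) < z].

(** Points of [C] outside [pair_closed] are dropped, so that nothing separates [b], [f1 b] and
    [f2 b] when [b] is paired. *)
Definition insert_pairs : set W := [set x | exists2 b, pair_closed b &
  x = b \/ paired b /\ (x = f1 b \/ x = f2 b)].

Lemma club_pair_closed : club a pair_closed.
Proof.
apply: (club_closure_points hW kinf ka Ca Ck
  (h := fun w => if pselect (paired w) then f2 w else w)) => x xa.
by case: pselect => // -[].
Qed.

Lemma pair_closed_lt b c x : pair_closed b -> pair_closed c -> b < c ->
  paired b -> x = f1 b \/ x = f2 b -> x < c.
Proof.
move=> [Cb _] [_ cP] bc pb; have := cP _ Cb bc; case: pselect => // pb' f2c.
by case=> -> //; apply: lt_trans f2c; case: pb.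
Qed.

Lemma paired_gt b x : paired b -> x = f1 b \/ x = f2 b -> b < x.
Proof. by move=> [b1 b2 _] [->|->] //; exact: lt_trans b2. Qed.

Lemma insert_pairs_below : insert_pairs `<=` below a.
Proof.
have [[ca _] _] := club_pair_closed.
move=> x [b cb [->|[[_ b2 ba] [->|->]]]] //; first exact: ca.
exact: lt_trans ba.
Qed.

(** A limit of the new set is a limit of closure points, since an interval free of closure points
    contains at most two new points. *)
Lemma club_insert_pairs : club a insert_pairs.
Proof.
have cc := club_pair_closed; have [[ca ccl] _] := cc.
apply: clubI; first exact: insert_pairs_below.
  move=> x xa /limit_pointP[x0 xP].
  suff cx : pair_closed x by exists x => //; left.
  apply: ccl => //; apply/limit_pointP; split=> // w wx.
  apply: contrapT => nw.
  (* With no closure point in [(w, x)], a new point there is inserted after a base at most [w]. *)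
  have base u : insert_pairs u -> w < u -> u < x ->
      exists b, [/\ pair_closed b, b <= w, paired b & u = f1 b \/ u = f2 b].
    move=> [b cb ub] wu ux.
    have bu : b <= u by case: ub => [->|[pb /(paired_gt pb)/ltW]].
    have bw : b <= w.
      rewrite leNgt; apply/negP => wb; apply: nw; exists b; split=> //.
      exact: le_lt_trans ux.
    case: ub => [ub|[pb ub]]; last by exists b.
    by move: wu; rewrite ub ltNge bw.
  have base_eq b c u v : pair_closed b -> pair_closed c -> b <= w -> c <= w ->
      w < u -> w < v -> paired b -> paired c ->
      u = f1 b \/ u = f2 b -> v = f1 c \/ v = f2 c -> b = c.
    move=> cb cc' bw cw wu wv pb pc ub vc; case: (ltgtP b c) => // [bc|cb'].
      by have := pair_closed_lt cb cc' bc pb ub; rewrite ltNge (le_trans cw) // ltW.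
    by have := pair_closed_lt cc' cb cb' pc vc; rewrite ltNge (le_trans bw) // ltW.
  (* Three increasing points with the same base [b] contradict that only [f1 b] and [f2 b] are
     available. *)
  have [u [cu wu ux]] := xP _ wx; have [v [cv uv vx]] := xP _ ux.
  have [r [cr vr rx]] := xP _ vx; have wv := lt_trans wu uv; have wr := lt_trans wv vr.
  have [b [cb bw pb ub]] := base _ cu wu ux.
  have [b' [cb' bw' pb' vb]] := base _ cv wv vx.
  have [b'' [cb'' bw'' pb'' rb]] := base _ cr wr rx.
  have E' := base_eq _ _ _ _ cb cb' bw bw' wu wv pb pb' ub vb.
  have E'' := base_eq _ _ _ _ cb cb'' bw bw'' wu wr pb pb'' ub rb.
  rewrite -{}E' in vb; rewrite -{}E'' in rb; have [_ b12 _] := pb.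
  have vb2 : v = f2 b.
    case: vb => // vb1; case: ub => ub; move: uv; rewrite ub vb1 ?ltxx //.
    by rewrite ltNge ltW.
  case: rb => rb; move: vr; rewrite rb vb2 ?ltxx //.
  by rewrite ltNge ltW.
move=> x /(club_next cc)[y [cy xy _]]; exists y => //; exists y => //; by left.
Qed.

(** The base of a new point below [x] lies in [C] below [x], so this segment of [C] and its images
    under [f1] and [f2] cover everything. *)
Lemma card_insert_pairs_below x : x < a -> insert_pairs `&` below x #<= below k.
Proof.
move=> xa; have kk := card_below_square hW kinf; set P := C `&` below x.
have : insert_pairs `&` below x `<=` P `|` (f1 @` P `|` f2 @` P).
  move=> y [[b [Cb bP] yb] yx].
  have Pb : P b.
    split=> //; case: yb => [<-//|[pb yb]]; apply: lt_trans yx; exact: paired_gt.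
  case: yb => [->|[_ [->|->]]]; [by left|by right; left; exists b|].
  by right; right; exists b.
have PK : P #<= below k by exact: Ck.
have fPK (f : W -> W) : f @` P #<= below k by apply: card_le_trans PK; exact: card_image_le.
by move=> /subset_card_le /card_le_trans; apply; do 2?apply: card_le_setU.
Qed.

(** Points with an earlier base are below [b], and points with a later base are beyond [f2 b]. *)
Lemma min_after_insert_pairs b : pair_closed b -> paired b ->
  min_after insert_pairs b (f1 b) /\ min_after insert_pairs (f1 b) (f2 b).
Proof.
move=> cb pb; have [b1 b12 _] := pb.
have cases u : insert_pairs u -> b < u -> [\/ u = f1 b, u = f2 b | f2 b < u].
  move=> [c cc uc] bu; case: (ltgtP b c) => bc.
  - apply: Or33; apply: (lt_le_trans (pair_closed_lt cb cc bc pb (or_intror erefl))).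
    by case: uc => [->//|[pc /(paired_gt pc)/ltW]].
  - case: uc => [uc|[pc uc]]; first by move: bu; rewrite uc ltNge ltW.
    by have := pair_closed_lt cc cb bc pc uc; rewrite ltNge ltW.
  - move: uc; rewrite -bc => -[ub|[_ [->|->]]]; [|exact: Or31|exact: Or32].
    by move: bu; rewrite ub ltxx.
split; split.
- split; first by exists b => //; right; split=> //; left.
  by apply/negP; rewrite -ltNge.
- move=> u [cu /negP]; rewrite -ltNge => /(cases _ cu)[->|->|/ltW] //; first exact: ltW.
  by apply: le_trans; exact: ltW.
- split; first by exists b => //; right; split=> //; right.
  by apply/negP; rewrite -ltNge.
- move=> u [cu /negP]; rewrite -ltNge => ub.
  have /(cases _ cu)[u1|->|/ltW] // := lt_trans b1 ub.
  by move: ub; rewrite u1 ltxx.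
Qed.

End InsertPairs.
End Assembly.

(** * From the guessing lemmas to the new C-sequence *)

Theorem theoremE (d : Order.disp_t) (W : orderType d) (hW : ordinals W)
    (nu lambda lambda' : W)
    (hnu : infinite_cardinal nu)
    (hlambda : successor_cardinal nu lambda)
    (hlambda' : successor_cardinal lambda lambda') :
  (exists C : W -> set W,
     bounded_C_sequence lambda (E_eq lambda' lambda) C /\
     forall D : set W, club lambda' D ->
       exists2 delta, E_eq lambda' lambda delta &
         sup_is (nacc (C delta) `&` D `&` E_lt lambda' lambda) delta) ->
  (exists C : W -> set W,
     bounded_C_sequence lambda (E_eq lambda' lambda) C /\
     forall D : set W, club lambda' D ->
       exists2 delta, E_eq lambda' lambda delta &
         stationary delta
           [set beta | beta < delta /\
              exists beta1 beta2 : W,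
                [/\ min_after (C delta) beta beta1, min_after (C delta) beta1 beta2,
                    D beta1 & D beta2]]).
Proof.
move=> [C [[Cclub Cotp] CD]]; have [_ kinf] := hnu.
have [[_ nul] _] := hlambda.
have l'cf : cf_above nu lambda'.
  apply: (cf_aboveW (ltW nul)); apply: (cf_above_successor hW) => //.
  by apply: sub_infinite_set kinf => x /lt_trans; apply.
set E := E_eq lambda' lambda.
have Ecf delta : E delta -> cf_above nu delta.
  by move=> [_]; exact: (cf_above_cofinality hW).
have Csmall delta x : E delta -> x < delta -> C delta `&` below x #<= below nu.
  move=> Ed; have [[Cd _] /(sup_isP Cd)Cu] := Cclub _ Ed.
  by have [t tl Ct] := Cotp _ Ed; exact: (order_type_card_below hW hlambda Cd Cu tl Ct).
pose N delta := (nacc (C delta) `&` E_lt lambda' lambda)%classic.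
have [|D Dc|f fE fg] := guess_interval hW kinf l'cf Ecf (C := C) (N := N) Cclub.
- by move=> delta x [].
- have [delta Ed dsup] := CD _ Dc; exists delta => //.
  have [[Cd _] _] := Cclub _ Ed.
  have Nd : (nacc (C delta) `&` D `&` E_lt lambda' lambda)%classic `<=` below delta.
    by move=> x [[[/Cd]]].
  by move=> x /((sup_isP Nd).1 dsup)[y [[Ny Dy] Ty] xy]; exists y.
have [|g gg] := guess_point hW kinf l'cf Ecf Csmall _ fE fg.
  by move=> delta x [[]].
have [|D|f1 [f2 ff]] := guess_pair hW kinf l'cf Ecf (T := E_lt lambda' lambda) (f := g).
(* A cofinal set of order type [s < lambda] has at most [nu] elements, and its enumeration supplies
   the candidates below [gamma]. *)
- move=> gamma [_ [s sl [[A [Ag Acof] As] _]]].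
  have : A #<= below nu.
    apply: card_le_trans (card_lt_successor hW hlambda sl).
    exact: order_type_card_le As.
  move=> /(card_le_cover gamma)[e eA]; exists e => x /Acof[y Ay xy].
  by have [i ik ei] := eA _ Ay; exists i => //; rewrite ei xy Ag.
- move=> /gg[delta Ed Sd]; exists delta => // c /Sd[x [[xg gd [_ Tg] Dg] cx]].
  by exists x.
pose C' delta := insert_pairs delta (C delta) (f1 delta) (f2 delta).
have C'club delta : E delta -> club delta (C' delta).
  by move=> Ed; apply: (club_insert_pairs hW kinf _ _ (Ecf _ Ed) (Cclub _ Ed)) => x; exact: Csmall.
exists C'; split.
  (* The bound [lambda] on the order type follows from the bound [nu] on the size of proper initial
     segments. *)
  split=> // delta Ed; apply: (order_type_le_successor hW hlambda (a := delta)).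
    by have [[]] := C'club _ Ed.
  have [[C'd _] _] := C'club _ Ed.
  by move=> x /C'd xd; apply: card_insert_pairs_below => // y; exact: Csmall.
move=> D /ff[delta Ed Sd]; exists delta => // K Kc.
have pc : club delta (pair_closed delta (C delta) (f1 delta) (f2 delta)).
  by apply: (club_pair_closed hW kinf _ _ (Ecf _ Ed) (Cclub _ Ed)) => x; exact: Csmall.
(* Intersecting [K] with the closure points makes [x] a base, so [f1 delta x] and [f2 delta x] are
   the next two points of [C' delta]. *)
have [x [[x1 x2 xd D1 D2] [Kx px]]] := Sd _ (club_setI hW kinf (Ecf _ Ed) Kc pc).
exists x; split=> //; split; first by apply: (lt_trans x1); exact: lt_trans xd.
by exists (f1 delta x), (f2 delta x); have [? ?] := min_after_insert_pairs px (And3 x1 x2 xd).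
Qed.
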